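(* A regular curve $\gamma$ in $\mathbb{H}^2(+)$ is a horo-catenary (with parameter $\lambda\in\mathbb{R}$) if and only if its curvature $\kappa_h$ satisfies $$\kappa_h=\frac{g(\mathbf{n},V)}{d_b+\lambda},$$ where $\mathbf{n}$ is the unit normal vector of $\gamma$ and $V(x,y)=y\,\partial_y$.
   Context: $\mathbb{H}^2$ is the upper half-plane $\{(x,y)\in\mathbb{R}^2:y>0\}$ with the metric $g=\frac{dx^2+dy^2}{y^2}$, and $\mathbb{H}^2(+)=\{(x,y)\in\mathbb{H}^2:y>1\}$. On $\mathbb{H}^2(+)$ the hyperbolic distance from $(x,y)$ to the horocycle $\mathcal{H}=\{(t,1):t\in\mathbb{R}\}$ is $d_b=\log y$; $V$ is the unit vector field tangent to the geodesics (vertical lines) orthogonal to $\mathcal{H}$, and $V=\nabla d_b$. Regular means $\gamma'(t)\neq0$ for all $t$. The potential energy of $\gamma(t)=(u(t),v(t))$, $t\in[a,b]$, is $$\mathcal{E}_{hor}[\gamma]=\int_a^b(\log v+\lambda)\frac{\sqrt{u'^2+v'^2}}{v}\,dt,$$ where $\lambda\in\mathbb{R}$ is a constant (a Lagrange multiplier). A horo-catenary is a critical point of $\mathcal{E}_{hor}$ (for variations with fixed endpoints), i.e. $(u,v)$ satisfies both Euler–Lagrange equations of the integrand. With $m=u'^2+v'^2$, the unit normal is $\mathbf{n}=v\frac{(-v',u')}{\sqrt m}$, and $\kappa_h$ is the geodesic curvature of $\gamma$ in $\mathbb{H}^2$ with respect to $\mathbf{n}$; explicitly $\kappa_h=v\,\frac{u'v''-u''v'}{m^{3/2}}+\frac{u'}{\sqrt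 m}$. *)

(* Defs.v *)
From Stdlib Require Import Reals Lra.
From Coquelicot Require Import Coquelicot.
Local Open Scope R_scope.

(** Points and tangent vectors of the upper half-plane are pairs of reals;
    curves are given by their two coordinate functions [u] and [v]. *)

Definition hyp_metric (p X Y : R * R) : R :=
  (fst X * fst Y + snd X * snd Y) / snd p ^ 2.

Definition hyp_dist (p q : R * R) : R :=
  2 * arcsinh (sqrt ((fst p - fst q) ^ 2 + (snd p - snd q) ^ 2)
               / (2 * sqrt (snd p * snd q))).

(** Distance from [p] to the horocycle [y = 1], for [p] with [1 < snd p]; see
    [d_b_attained] and [d_b_min].  A quotient by [d_b p + lambda] is [0] where
    the denominator vanishes ([Rinv_0]). *)
Definition d_b (p : R * R) : R := ln (snd p).

Definition V (p : R * R) : R * R := (0, snd p).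

(** Class [C^2] on [[a, b]].  [Derive] is the two-sided derivative, so the
    function is required to be twice differentiable on a neighbourhood of every
    point of [[a, b]], endpoints included; every function that is [C^2] on
    [[a, b]] in the one-sided sense has such an extension, and everything below
    depends only on its values on [[a, b]]. *)
Definition C2_on (a b : R) (f : R -> R) : Prop :=
  forall t, a <= t <= b ->
    locally t (fun s => ex_derive f s /\ ex_derive (Derive f) s) /\
    continuous (Derive (Derive f)) t.

Definition regular_curve (a b : R) (u v : R -> R) : Prop :=
  C2_on a b u /\ C2_on a b v /\
  forall t, a <= t <= b -> (Derive u t, Derive v t) <> (0, 0).

Definition in_H2plus (a b : R) (v : R -> R) : Prop :=
  forall t, a <= t <= b -> 1 < v t.

Definition speed_sq (u v : R -> R) (t : R) : R := Derive u t ^ 2 + Derive v t ^ 2.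

Definition unit_normal (u v : R -> R) (t : R) : R * R :=
  (v t * (- Derive v t) / sqrt (speed_sq u v t),
   v t * Derive u t / sqrt (speed_sq u v t)).

(** The Levi-Civita covariant derivative of [(u', v')] along the curve; the
    nonzero Christoffel symbols of the metric are, at height [y],
    [Gamma^x_xy = Gamma^x_yx = Gamma^y_yy = - 1 / y] and
    [Gamma^y_xx = 1 / y]. *)
Definition cov_accel (u v : R -> R) (t : R) : R * R :=
  (Derive (Derive u) t - 2 * Derive u t * Derive v t / v t,
   Derive (Derive v) t + (Derive u t ^ 2 - Derive v t ^ 2) / v t).

(** Geodesic curvature with respect to [unit_normal], for an arbitrary
    parametrization. *)
Definition kappa_h (u v : R -> R) (t : R) : R :=
  hyp_metric (u t, v t) (cov_accel u v t) (unit_normal u v t)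
  / hyp_metric (u t, v t) (Derive u t, Derive v t) (Derive u t, Derive v t).

Definition energy_hor (lambda a b : R) (u v : R -> R) : R :=
  RInt (fun t => (ln (v t) + lambda) *
                 (sqrt (Derive u t ^ 2 + Derive v t ^ 2) / v t)) a b.

(** Critical points: the first variation vanishes along every variation
    [(u + eps xi, v + eps eta)] fixing the endpoints.  For small [eps] the varied
    curve stays regular and in the region [v > 1]. *)
Definition horo_catenary (lambda a b : R) (u v : R -> R) : Prop :=
  forall xi eta : R -> R,
    C2_on a b xi -> C2_on a b eta ->
    xi a = 0 -> xi b = 0 -> eta a = 0 -> eta b = 0 ->
    is_derive (fun eps => energy_hor lambda a b
                            (fun t => u t + eps * xi t)
                            (fun t => v t + eps * eta t)) 0 0.

Lemma unit_normal_unit (u v : R -> R) (t : R) :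
  0 < v t -> 0 < speed_sq u v t ->
  hyp_metric (u t, v t) (unit_normal u v t) (unit_normal u v t) = 1.
Proof.
intros Hv Hm.
unfold hyp_metric, unit_normal; simpl fst; simpl snd.
assert (Hs : 0 < sqrt (speed_sq u v t)) by now apply sqrt_lt_R0.
assert (Hq : sqrt (speed_sq u v t) ^ 2 = speed_sq u v t)
  by (apply pow2_sqrt; lra).
set (s := sqrt _) in *.
unfold speed_sq in Hq.
transitivity ((Derive u t ^ 2 + Derive v t ^ 2) / s ^ 2).
- field; split; lra.
- rewrite <- Hq; field; lra.
Qed.

Lemma kappa_hE (u v : R -> R) (t : R) :
  0 < v t -> 0 < speed_sq u v t ->
  kappa_h u v t =
    v t * (Derive u t * Derive (Derive v) t - Derive (Derive u) t * Derive v t)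
      / sqrt (speed_sq u v t) ^ 3
    + Derive u t / sqrt (speed_sq u v t).
Proof.
intros Hv Hm.
unfold kappa_h, hyp_metric, unit_normal, cov_accel; simpl fst; simpl snd.
assert (Hs : 0 < sqrt (speed_sq u v t)) by now apply sqrt_lt_R0.
assert (Hq : sqrt (speed_sq u v t) ^ 2 = speed_sq u v t)
  by (apply pow2_sqrt; lra).
set (s := sqrt _) in *.
replace (Derive u t * Derive u t + Derive v t * Derive v t) with (s ^ 2)
  by (rewrite Hq; unfold speed_sq; ring).
transitivity
  (v t * (Derive u t * Derive (Derive v) t - Derive (Derive u) t * Derive v t)
      / s ^ 3 + Derive u t * (Derive u t ^ 2 + Derive v t ^ 2) / s ^ 3).
- field; split; lra.
- unfold speed_sq in Hq; rewrite <- Hq; field; lra.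
Qed.

Lemma d_b_attained (x y : R) : 1 < y -> hyp_dist (x, y) (x, 1) = d_b (x, y).
Proof.
intros Hy.
unfold hyp_dist, d_b; simpl fst; simpl snd.
replace ((x - x) ^ 2 + (y - 1) ^ 2) with ((y - 1) ^ 2) by ring.
rewrite sqrt_pow2 by lra; rewrite Rmult_1_r.
assert (Hs : 0 < sqrt y) by (apply sqrt_lt_R0; lra).
assert (Hq : sqrt y * sqrt y = y) by (apply sqrt_sqrt; lra).
replace ((y - 1) / (2 * sqrt y)) with (sinh (ln (sqrt y))).
- rewrite arcsinh_sinh.
  rewrite <- Hq at 2.
  rewrite ln_mult by assumption; ring.
- unfold sinh; rewrite exp_Ropp, exp_ln by assumption.
  rewrite <- Hq at 3; field; lra.
Qed.

Lemma d_b_min (x y t : R) : 1 < y -> d_b (x, y) <= hyp_dist (x, y) (t, 1).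
Proof.
intros Hy.
rewrite <- d_b_attained by assumption.
unfold hyp_dist; simpl fst; simpl snd.
apply Rmult_le_compat_l; [lra|].
apply arcsinh_le.
apply Rmult_le_compat_r.
- apply Rlt_le, Rinv_0_lt_compat, Rmult_lt_0_compat; [lra|].
  apply sqrt_lt_R0; lra.
- apply sqrt_le_1_alt.
  assert (0 <= (x - t) ^ 2) by apply pow2_ge_0.
  replace (x - x) with 0 by ring; lra.
Qed.

(* Main.v *)
(** Write [phi = ln v + lambda] and [s = sqrt (u'^2 + v'^2)].  Up to sign, the
    two Euler-Lagrange expressions of the energy are the products of the scalar
    [phi * kappa_h - u' / s] with [v' / v^2] and [u' / v^2], and
    [u' / s = g(n, V)]; by regularity they both vanish exactly when this scalar
    does.  The momenta being [C^1], the du Bois-Reymond argument applies with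
    their own primitives as test functions.  The points where [phi = 0], at
    which the curvature equation degenerates, need a separate argument. *)

Require Import Defs.
From Stdlib Require Import Reals Lra Classical ClassicalEpsilon.
From Coquelicot Require Import Coquelicot.
Local Open Scope R_scope.

(** Two obstacles shape the proof. Every identity is known on the closed segment only, while
    [Derive] is two-sided and [C2_on] reaches beyond the endpoints. So derivatives at an endpoint
    are read off from increments pointing into the segment, and test functions are built as
    primitives on a slightly larger interval. The regularity matches: a [C^2] curve has [C^1]
    momenta, whose primitives are again [C^2] and hence admissible variations. Moreover the
    integrand is smooth only at positive height and nonzero speed. Differentiating the energy under
    the integral sign thus needs a single range of [eps] that keeps the varied curve in this domain
    for all [t] at once, which compactness of [[a, b]] provides. *)

(** * Continuity of real expressions, and two facts about compact segments *)

Lemma continuous_Rmult {T : UniformSpace} (f g : T -> R) (x : T) :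
  continuous f x -> continuous g x -> continuous (fun y => f y * g y) x.
Proof. exact (continuous_mult (K := R_AbsRing) f g x). Qed.

Lemma continuous_Rplus {T : UniformSpace} (f g : T -> R) (x : T) :
  continuous f x -> continuous g x -> continuous (fun y => f y + g y) x.
Proof. exact (continuous_plus (K := R_AbsRing) (V := R_NormedModule) f g x). Qed.

Lemma continuous_Rminus {T : UniformSpace} (f g : T -> R) (x : T) :
  continuous f x -> continuous g x -> continuous (fun y => f y - g y) x.
Proof. exact (continuous_minus (K := R_AbsRing) (V := R_NormedModule) f g x). Qed.

Lemma continuous_derivable_comp {T : UniformSpace} (f : T -> R) (g : R -> R) (x : T) :
  continuous f x -> ex_derive g (f x) -> continuous (fun y => g (f y)) x.
Proof.
intros Hf Hg; apply continuous_comp; [exact Hf|].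
now apply (ex_derive_continuous (K := R_AbsRing) (V := R_NormedModule)).
Qed.

Lemma continuous_Rdiv {T : UniformSpace} (f g : T -> R) (x : T) :
  continuous f x -> continuous g x -> g x <> 0 -> continuous (fun y => f y / g y) x.
Proof.
intros Hf Hg H0; apply continuous_Rmult; [exact Hf|].
apply (continuous_derivable_comp g Rinv); [exact Hg|].
now auto_derive.
Qed.

Lemma continuous_Rpow {T : UniformSpace} (f : T -> R) (n : nat) (x : T) :
  continuous f x -> continuous (fun y => f y ^ n) x.
Proof.
intros Hf; apply (continuous_derivable_comp f (fun z => z ^ n)); [exact Hf|].
now auto_derive.
Qed.

Lemma continuous_locally_pos {T : UniformSpace} (f : T -> R) (x : T) :
  continuous f x -> 0 < f x -> locally x (fun y => 0 < f y).
Proof.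
intros Hf H0; apply (Hf (fun z => 0 < z)).
now apply (open_gt 0).
Qed.

Lemma continuous_locally_neq0 {T : UniformSpace} (f : T -> R) (x : T) :
  continuous f x -> f x <> 0 -> locally x (fun y => f y <> 0).
Proof.
intros Hf H0; apply (Hf (fun z => z <> 0)).
now apply (open_neq 0).
Qed.

(** One-sided information at an endpoint determines the two-sided derivative. *)
Lemma Derive_const_segment (f : R -> R) (c a b t : R) :
  a < b -> a <= t <= b -> ex_derive f t ->
  (forall s, a <= s <= b -> f s = c) -> Derive f t = 0.
Proof.
intros Hab Ht Hd Hc.
apply Derive_correct in Hd; apply is_derive_Reals in Hd.
set (l := Derive f t) in *.
destruct (Req_dec l 0) as [H0|H0]; [exact H0|exfalso].
destruct (Hd (Rabs l / 2)) as [d Hd'].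
{ assert (0 < Rabs l) by now apply Rabs_pos_lt. lra. }
(* A small increment that stays in [[a, b]]: to the right, or to the left when [t = b]. Its
   difference quotient is exactly [0], too far from [l]. *)
assert (Hh : exists h, h <> 0 /\ Rabs h < d /\ a <= t + h <= b).
{ assert (Hd0 := cond_pos d).
  destruct (Rlt_dec t b) as [Htb|Htb].
  - exists (Rmin (d / 2) (b - t)).
    assert (0 < Rmin (d / 2) (b - t)) by (apply Rmin_glb_lt; lra).
    assert (Rmin (d / 2) (b - t) <= d / 2) by apply Rmin_l.
    assert (Rmin (d / 2) (b - t) <= b - t) by apply Rmin_r.
    rewrite Rabs_pos_eq by lra; lra.
  - exists (- Rmin (d / 2) (t - a)).
    assert (0 < Rmin (d / 2) (t - a)) by (apply Rmin_glb_lt; lra).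
    assert (Rmin (d / 2) (t - a) <= d / 2) by apply Rmin_l.
    assert (Rmin (d / 2) (t - a) <= t - a) by apply Rmin_r.
    rewrite Rabs_Ropp, Rabs_pos_eq by lra; lra. }
destruct Hh as (h & Hh0 & Hhd & Hht).
specialize (Hd' h Hh0 Hhd).
rewrite (Hc (t + h)), (Hc t) in Hd' by lra.
replace ((c - c) / h - l) with (- l) in Hd' by (field; exact Hh0).
rewrite Rabs_Ropp in Hd'.
assert (0 < Rabs l) by now apply Rabs_pos_lt. lra.
Qed.

(** The tube lemma: compactness of [[a, b]] turns neighbourhoods depending on [t] into one that
    serves all [t]. *)
Lemma locally_tube {T : UniformSpace} (x : T) (a b : R) (P : T -> R -> Prop) :
  (forall t, a <= t <= b -> locally (x, t) (fun z => P (fst z) (snd z))) ->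
  locally x (fun e => forall t, a <= t <= b -> P e t).
Proof.
intros HP.
assert (Hex : forall t, exists d : posreal,
    a <= t <= b -> forall z : T * R, ball (x, t) d z -> P (fst z) (snd z)).
{ intros t.
  destruct (classic (a <= t <= b)) as [Ht|Ht].
  - destruct (HP t Ht) as [d Hd]; now exists d.
  - exists (mkposreal 1 Rlt_0_1); intros H; contradiction. }
(* The compactness theorem takes a radius for every real [t], hence the choice principle and the
   dummy radius [1] outside [[a, b]]. *)
set (delta := fun t => proj1_sig (constructive_indefinite_description _ (Hex t))).
assert (Hdelta : forall t, a <= t <= b ->
    forall z : T * R, ball (x, t) (delta t) z -> P (fst z) (snd z))
  by (intros t; exact (proj2_sig (constructive_indefinite_description _ (Hex t)))).
destruct (compactness_value_1d a b delta) as [d Hd].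
exists d; intros e He t Ht.
(* [compactness_value_1d] yields its covering point only under a double negation. *)
apply NNPP; intros HnP.
apply (Hd t Ht); intros (s & Hs & Hts & Hds); apply HnP.
apply (Hdelta s Hs (e, t)); split; simpl.
- now apply ball_le with d.
- exact Hts.
Qed.

(** * Calculus of functions that are [C^1] at a point *)

(** The derivative is continuous at [t] alone: this is what [C2_on] grants to [Derive f] at each
    point of the segment. *)
Definition C1_at (f : R -> R) (t : R) : Prop :=
  locally t (ex_derive f) /\ continuous (Derive f) t.

Lemma C1_at_ex_derive (f : R -> R) (t : R) : C1_at f t -> ex_derive f t.
Proof. intros [H _]; exact (locally_singleton _ _ H). Qed.

Lemma C1_at_continuous (f : R -> R) (t : R) : C1_at f t -> continuous f t.
Proof.
intros H; apply (ex_derive_continuous (K := R_AbsRing) (V := R_NormedModule)).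
now apply C1_at_ex_derive.
Qed.

Lemma C1_at_intro (f df : R -> R) (t : R) :
  locally t (fun s => is_derive f s (df s)) -> continuous df t -> C1_at f t.
Proof.
intros Hd Hc; split.
- revert Hd; apply filter_imp; intros s Hs; now exists (df s).
- apply continuous_ext_loc with df; [|exact Hc].
  revert Hd; apply filter_imp; intros s Hs; symmetry; now apply is_derive_unique.
Qed.

Lemma C1_at_const (c t : R) : C1_at (fun _ => c) t.
Proof.
apply C1_at_intro with (fun _ => 0); [|apply continuous_const].
apply filter_forall; intros s; apply (is_derive_const (K := R_AbsRing) (V := R_NormedModule)).
Qed.

Lemma C1_at_plus (f g : R -> R) (t : R) :
  C1_at f t -> C1_at g t -> C1_at (fun s => f s + g s) t.
Proof.
intros [Hf Hf'] [Hg Hg'].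
apply C1_at_intro with (fun s => Derive f s + Derive g s).
- generalize (filter_and _ _ Hf Hg); apply filter_imp; intros s [Hfs Hgs].
  auto_derive; [tauto|change (fun x => f x) with f; change (fun x => g x) with g; ring].
- now apply continuous_Rplus.
Qed.

Lemma C1_at_mult (f g : R -> R) (t : R) :
  C1_at f t -> C1_at g t -> C1_at (fun s => f s * g s) t.
Proof.
intros Cf Cg.
assert (Kf := C1_at_continuous _ _ Cf); assert (Kg := C1_at_continuous _ _ Cg).
destruct Cf as [Hf Hf'], Cg as [Hg Hg'].
apply C1_at_intro with (fun s => Derive f s * g s + f s * Derive g s).
- generalize (filter_and _ _ Hf Hg); apply filter_imp; intros s [Hfs Hgs].
  auto_derive; [tauto|change (fun x => f x) with f; change (fun x => g x) with g; ring].
- now apply continuous_Rplus; apply continuous_Rmult.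
Qed.

Lemma C1_at_minus (f g : R -> R) (t : R) :
  C1_at f t -> C1_at g t -> C1_at (fun s => f s - g s) t.
Proof.
intros [Hf Hf'] [Hg Hg'].
apply C1_at_intro with (fun s => Derive f s - Derive g s).
- generalize (filter_and _ _ Hf Hg); apply filter_imp; intros s [Hfs Hgs].
  auto_derive; [tauto|change (fun x => f x) with f; change (fun x => g x) with g; ring].
- now apply continuous_Rminus.
Qed.

Lemma C1_at_comp (f g : R -> R) (t : R) :
  C1_at f t -> C1_at g (f t) -> C1_at (fun s => g (f s)) t.
Proof.
intros Cf [Hg Hg'].
assert (Kf := C1_at_continuous _ _ Cf).
destruct Cf as [Hf Hf'].
apply C1_at_intro with (fun s => Derive f s * Derive g (f s)).
- generalize (filter_and _ _ Hf (Kf _ Hg)); apply filter_imp; intros s [Hfs Hgs].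
  auto_derive; [tauto|change (fun x => f x) with f; change (fun x => g x) with g; ring].
- apply continuous_Rmult; [exact Hf'|].
  now apply (continuous_comp f (Derive g)).
Qed.

Lemma C1_at_pos (g dg : R -> R) (x : R) :
  (forall y, 0 < y -> is_derive g y (dg y)) -> 0 < x -> ex_derive dg x -> C1_at g x.
Proof.
intros Hd Hx Hc; apply C1_at_intro with dg.
- generalize (open_gt 0 x Hx); apply filter_imp; intros y Hy; now apply Hd.
- now apply (ex_derive_continuous (K := R_AbsRing) (V := R_NormedModule)).
Qed.

Lemma C1_at_ln (x : R) : 0 < x -> C1_at ln x.
Proof.
intros Hx; apply C1_at_pos with Rinv; [|exact Hx|].
- intros y Hy; now apply is_derive_ln.
- auto_derive; lra.
Qed.

Lemma C1_at_sqrt (x : R) : 0 < x -> C1_at sqrt x.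
Proof.
intros Hx; apply C1_at_pos with (fun y => / (2 * sqrt y)); [|exact Hx|].
- intros y Hy; auto_derive; [exact Hy|ring].
- assert (0 < sqrt x) by now apply sqrt_lt_R0.
  auto_derive; repeat split; lra.
Qed.

Lemma C1_at_inv (x : R) : 0 < x -> C1_at Rinv x.
Proof.
intros Hx; apply C1_at_pos with (fun y => - / (y * y)); [|exact Hx|].
- intros y Hy; auto_derive; [lra|field; lra].
- auto_derive; nra.
Qed.

Lemma C1_at_pow (f : R -> R) (n : nat) (t : R) : C1_at f t -> C1_at (fun s => f s ^ n) t.
Proof.
intros Hf; induction n as [|n IH]; simpl; [apply C1_at_const|].
now apply C1_at_mult.
Qed.

Lemma C1_at_div (f g : R -> R) (t : R) :
  C1_at f t -> C1_at g t -> 0 < g t -> C1_at (fun s => f s / g s) t.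
Proof.
intros Hf Hg H0; apply C1_at_mult; [exact Hf|].
apply (C1_at_comp g Rinv); [exact Hg|now apply C1_at_inv].
Qed.

Lemma C2_on_C1 (a b : R) (f : R -> R) (t : R) :
  C2_on a b f -> a <= t <= b -> C1_at f t /\ C1_at (Derive f) t.
Proof.
intros H Ht; destruct (H t Ht) as [Hl Hc].
split; split; try exact Hc.
- revert Hl; apply filter_imp; tauto.
- apply (ex_derive_continuous (K := R_AbsRing) (V := R_NormedModule)).
  now destruct (locally_singleton _ _ Hl).
- revert Hl; apply filter_imp; tauto.
Qed.

(** * Integrals over a segment and the du Bois-Reymond lemma *)

Lemma ex_RInt_segment (f : R -> R) (a b : R) :
  a <= b -> (forall t, a <= t <= b -> continuous f t) -> ex_RInt f a b.
Proof.
intros Hab Hc; apply (ex_RInt_continuous (V := R_CompleteNormedModule)).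
now rewrite Rmin_left, Rmax_right.
Qed.

Lemma RInt_ext_segment (f g : R -> R) (a b : R) :
  a <= b -> (forall t, a <= t <= b -> f t = g t) -> RInt f a b = RInt g a b.
Proof.
intros Hab Hfg; apply (RInt_ext (V := R_CompleteNormedModule)).
rewrite Rmin_left, Rmax_right by exact Hab; intros t Ht; apply Hfg; lra.
Qed.

(** For [F] to be in [C2_on] it must be twice differentiable past both endpoints. [C1_at] at [a] and
    at [b] makes [f] differentiable on an interval from [a - da] to [b + db], and the primitive is
    studied on all of it. *)
Lemma C1_antiderivative (f : R -> R) (a b : R) :
  a < b -> (forall t, a <= t <= b -> C1_at f t) ->
  exists F, C2_on a b F /\ F a = 0 /\ F b = RInt f a b /\
    forall t, a <= t <= b -> Derive F t = f t.
Proof.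
intros Hab Hf.
destruct (proj1 (Hf a ltac:(lra))) as [da Ha].
destruct (proj1 (Hf b ltac:(lra))) as [db Hb].
set (F := fun t => RInt f a t).
assert (Hpa := cond_pos da); assert (Hpb := cond_pos db).
assert (Hex : forall s, a - da < s < b + db -> ex_derive f s).
{ intros s Hs.
  destruct (Rlt_dec s a); [|destruct (Rlt_dec b s)].
  - apply Ha; change (Rabs (s - a) < da); apply Rabs_def1; lra.
  - apply Hb; change (Rabs (s - b) < db); apply Rabs_def1; lra.
  - apply C1_at_ex_derive, Hf; lra. }
assert (Hloc : forall s, a - da < s < b + db ->
    locally s (fun r => a - da < r < b + db)).
{ intros s [Hs1 Hs2].
  exact (filter_and _ _ (open_gt _ s Hs1) (open_lt _ s Hs2)). }
assert (HF : forall s, a - da < s < b + db -> is_derive F s (f s)).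
{ intros s Hs; apply (is_derive_RInt (V := R_NormedModule)) with a.
  - generalize (Hloc s Hs); apply filter_imp; intros r Hr.
    apply (RInt_correct (V := R_CompleteNormedModule)).
    apply (ex_RInt_continuous (V := R_CompleteNormedModule)); intros z Hz.
    apply (ex_derive_continuous (K := R_AbsRing) (V := R_NormedModule)), Hex.
    revert Hz; unfold Rmin, Rmax; destruct (Rle_dec a r); lra.
  - now apply (ex_derive_continuous (K := R_AbsRing) (V := R_NormedModule)), Hex. }
assert (HD : forall s, a - da < s < b + db -> Derive F s = f s)
  by (intros s Hs; now apply is_derive_unique, HF).
assert (HDl : forall s, a - da < s < b + db -> locally s (fun r => f r = Derive F r)).
{ intros s Hs; generalize (Hloc s Hs); apply filter_imp; intros r Hr.
  symmetry; now apply HD. }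
exists F; repeat split.
- generalize (Hloc t ltac:(lra)); apply filter_imp; intros s Hs; split.
  + exists (f s); now apply HF.
  + apply ex_derive_ext_loc with f; [now apply HDl|now apply Hex].
- apply continuous_ext_loc with (Derive f); [|now apply Hf].
  generalize (Hloc t ltac:(lra)); apply filter_imp; intros s Hs.
  now apply Derive_ext_loc, HDl.
- apply (RInt_point (V := R_CompleteNormedModule)).
- intros t Ht; apply HD; lra.
Qed.

Lemma RInt_Derive_C1 (a b : R) (F : R -> R) :
  a < b -> (forall t, a <= t <= b -> C1_at F t) -> RInt (Derive F) a b = F b - F a.
Proof.
intros Hab HF; apply RInt_Derive; intros t Ht;
  rewrite Rmin_left, Rmax_right in Ht by lra.
- now apply C1_at_ex_derive, HF.
- now apply HF.
Qed.

(** A primitive of [f] is nondecreasing and takes the value [0] at both ends, so it is [0] on the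
    whole segment, and so is its derivative. *)
Lemma RInt_ge0_eq0 (a b : R) (f : R -> R) :
  a < b -> (forall t, a <= t <= b -> C1_at f t) -> (forall t, a <= t <= b -> 0 <= f t) ->
  RInt f a b = 0 -> forall t, a <= t <= b -> f t = 0.
Proof.
intros Hab Hc Hp H0.
destruct (C1_antiderivative f a b Hab Hc) as (F & HF & HFa & HFb & HFd).
assert (Hd : forall t, a <= t <= b -> ex_derive F t)
  by (intros t Ht; exact (C1_at_ex_derive _ _ (proj1 (C2_on_C1 a b F t HF Ht)))).
assert (Hmono : forall x y, a <= x -> x <= y -> y <= b -> F x <= F y).
{ intros x y Hx Hxy Hy.
  destruct (MVT_gen F x y (Derive F)) as (c & Hc1 & Hc2).
  - intros z; rewrite Rmin_left, Rmax_right by lra; intros Hz.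
    apply Derive_correct, Hd; lra.
  - intros z; rewrite Rmin_left, Rmax_right by lra; intros Hz.
    apply continuity_pt_filterlim.
    apply (ex_derive_continuous (K := R_AbsRing) (V := R_NormedModule)), Hd; lra.
  - rewrite Rmin_left, Rmax_right in Hc1 by lra.
    rewrite HFd in Hc2 by lra.
    assert (0 <= f c * (y - x)) by (apply Rmult_le_pos; [apply Hp|]; lra).
    lra. }
intros t Ht; rewrite <- HFd by exact Ht.
apply (Derive_const_segment F 0 a b t Hab Ht (Hd t Ht)).
intros s Hs.
assert (H1 := Hmono a s ltac:(lra) ltac:(lra) ltac:(lra)).
assert (H2 := Hmono s b ltac:(lra) ltac:(lra) ltac:(lra)).
lra.
Qed.

(** Since [K] is [C^1], its own primitive (corrected by the mean) is an
    admissible test function. *)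
Lemma du_Bois_Reymond_C1 (a b : R) (K : R -> R) :
  a < b -> (forall t, a <= t <= b -> C1_at K t) ->
  (forall F, C2_on a b F -> F a = 0 -> F b = 0 ->
     RInt (fun t => K t * Derive F t) a b = 0) ->
  forall t, a <= t <= b -> Derive K t = 0.
Proof.
intros Hab HK Htest.
(* With [c] the mean of [K], the primitive of [K - c] from [a] vanishes at [b] too. *)
set (c := RInt K a b / (b - a)).
set (g := fun t => K t - c).
assert (Hg : forall t, a <= t <= b -> C1_at g t).
{ intros t Ht; apply C1_at_minus; [now apply HK|apply C1_at_const]. }
assert (HexK : ex_RInt K a b)
  by (apply ex_RInt_segment; [lra|]; intros t Ht; now apply C1_at_continuous, HK).
assert (Hexg : ex_RInt g a b)
  by (apply ex_RInt_segment; [lra|]; intros t Ht; now apply C1_at_continuous, Hg).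
assert (Hexp : ex_RInt (fun t => K t * g t) a b).
{ apply ex_RInt_segment; [lra|]; intros t Ht.
  apply C1_at_continuous, C1_at_mult; [now apply HK|now apply Hg]. }
assert (Hmean : RInt g a b = 0).
{ unfold g.
  rewrite (RInt_minus (V := R_CompleteNormedModule) K (fun _ => c)), RInt_const;
    [|exact HexK|apply ex_RInt_const].
  change (RInt K a b - (b - a) * c = 0); unfold c; field; lra. }
destruct (C1_antiderivative g a b Hab Hg) as (F & HF & HFa & HFb & HFd).
assert (HKg : RInt (fun t => K t * g t) a b = 0).
{ rewrite <- (Htest F HF HFa ltac:(now rewrite HFb)).
  apply RInt_ext_segment; [lra|]; intros t Ht; rewrite HFd by lra; reflexivity. }
(* [g ^ 2 = K g - c g]: the first term integrates to [0] by the test hypothesis, the second because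
   [g] has mean zero. *)
assert (Hsq : forall t, a <= t <= b -> g t ^ 2 = 0).
{ apply RInt_ge0_eq0; [exact Hab| | |].
  - intros t Ht; now apply C1_at_pow, Hg.
  - intros t _; apply pow2_ge_0.
  - transitivity (RInt (fun t => minus (K t * g t) (scal c (g t))) a b).
    + apply RInt_ext_segment; [lra|]; intros t _.
      change (g t ^ 2 = K t * g t - c * g t); unfold g; ring.
    + rewrite (RInt_minus (V := R_CompleteNormedModule) (fun t => K t * g t));
        [|exact Hexp|now apply (ex_RInt_scal (V := R_NormedModule))].
      rewrite (RInt_scal (V := R_CompleteNormedModule)) by exact Hexg.
      rewrite HKg, Hmean; change (0 - c * 0 = 0); ring. }
intros t Ht; apply (Derive_const_segment K c a b t Hab Ht).
- now apply C1_at_ex_derive, HK.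
- intros s Hs.
  assert (H0 := Hsq s Hs); unfold g in H0.
  assert (K s - c = 0) by (apply Rsqr_0_uniq; unfold Rsqr; lra).
  lra.
Qed.

(** * The Lagrangian and its differential *)

(** The arguments [w], [p], [q] stand for [v], [u'], [v']. The coordinate [u] does not occur:
    horizontal translations are isometries preserving the horocycle. *)
Definition lagrangian (l w p q : R) : R := (ln w + l) * (sqrt (p ^ 2 + q ^ 2) / w).

(** [momentum l w p q p] and [momentum l w p q q] are the derivatives of the
    Lagrangian in [p] and [q], and [force] is its derivative in [w]. *)
Definition momentum (l w p q r : R) : R := (ln w + l) * r / (sqrt (p ^ 2 + q ^ 2) * w).

Definition force (l w p q : R) : R := sqrt (p ^ 2 + q ^ 2) * (1 - (ln w + l)) / w ^ 2.

(** The differential of the Lagrangian at [(w, p, q)] applied to [(h, x, y)]. *)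
Definition variation (l w p q h x y : R) : R :=
  force l w p q * h + momentum l w p q p * x + momentum l w p q q * y.

Lemma is_derive_lagrangian (l w p q h x y e : R) :
  0 < w + e * h -> 0 < (p + e * x) ^ 2 + (q + e * y) ^ 2 ->
  is_derive (fun z => lagrangian l (w + z * h) (p + z * x) (q + z * y)) e
    (variation l (w + e * h) (p + e * x) (q + e * y) h x y).
Proof.
intros Hw Hm; unfold lagrangian, variation, force, momentum.
assert (Hs := sqrt_lt_R0 _ Hm).
assert (Hq := pow2_sqrt _ (Rlt_le _ _ Hm)).
auto_derive.
- repeat split; lra.
- set (w' := w + e * h) in *; set (p' := p + e * x) in *; set (q' := q + e * y) in *.
  replace (p' * (p' * 1) + q' * (q' * 1)) with (p' ^ 2 + q' ^ 2) by ring.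
  set (s := sqrt _) in *; field; lra.
Qed.

(** * Continuity of these expressions, used both over [R] and over [R * R] *)

Section Continuity.

Context {T : UniformSpace} (l : R) (w p q : T -> R) (z : T).
Hypotheses (Cw : continuous w z) (Cp : continuous p z) (Cq : continuous q z).
Hypotheses (Hw : 0 < w z) (Hm : 0 < p z ^ 2 + q z ^ 2).

Let continuous_speed : continuous (fun t => sqrt (p t ^ 2 + q t ^ 2)) z.
Proof.
apply (continuous_derivable_comp (fun t => p t ^ 2 + q t ^ 2) sqrt).
- now apply continuous_Rplus; apply continuous_Rpow.
- now auto_derive.
Qed.

Let continuous_phi : continuous (fun t => ln (w t) + l) z.
Proof.
apply continuous_Rplus; [|apply continuous_const].
apply (continuous_derivable_comp w ln); [exact Cw|now auto_derive].
Qed.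

Lemma continuous_lagrangian : continuous (fun t => lagrangian l (w t) (p t) (q t)) z.
Proof.
apply continuous_Rmult; [exact continuous_phi|].
apply continuous_Rdiv; [exact continuous_speed|exact Cw|lra].
Qed.

Lemma continuous_momentum (r : T -> R) :
  continuous r z -> continuous (fun t => momentum l (w t) (p t) (q t) (r t)) z.
Proof.
intros Cr; assert (Hs := sqrt_lt_R0 _ Hm).
apply continuous_Rdiv.
- now apply continuous_Rmult.
- now apply continuous_Rmult.
- apply Rgt_not_eq, Rmult_lt_0_compat; assumption.
Qed.

Lemma continuous_force : continuous (fun t => force l (w t) (p t) (q t)) z.
Proof.
apply continuous_Rdiv.
- apply continuous_Rmult; [exact continuous_speed|].
  apply continuous_Rminus; [apply continuous_const|exact continuous_phi].
- now apply continuous_Rpow.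
- apply pow_nonzero; lra.
Qed.

Lemma continuous_variation (h x y : T -> R) :
  continuous h z -> continuous x z -> continuous y z ->
  continuous (fun t => variation l (w t) (p t) (q t) (h t) (x t) (y t)) z.
Proof.
intros Ch Cx Cy; unfold variation.
apply continuous_Rplus; [apply continuous_Rplus|].
- now apply continuous_Rmult; [exact continuous_force|].
- now apply continuous_Rmult; [apply continuous_momentum|].
- now apply continuous_Rmult; [apply continuous_momentum|].
Qed.

End Continuity.

(** * First variation of the energy *)

Lemma speed_sq_pos (a b : R) (u v : R -> R) (t : R) :
  regular_curve a b u v -> a <= t <= b -> 0 < Derive u t ^ 2 + Derive v t ^ 2.
Proof.
intros (_ & _ & Hr) Ht; specialize (Hr t Ht).
assert (H1 := pow2_ge_0 (Derive u t)); assert (H2 := pow2_ge_0 (Derive v t)).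
destruct (Rtotal_order 0 (Derive u t ^ 2 + Derive v t ^ 2)) as [H|[H|H]]; try lra.
exfalso; apply Hr; f_equal; apply Rsqr_0_uniq; unfold Rsqr; lra.
Qed.

(** Differentiation under the integral sign. The integrand is differentiable in [e] where [good]
    holds; this open condition is true at [e = 0] by regularity and [v > 1], and the tube lemma
    extends it to all small [e], uniformly in [t]. *)
Lemma is_derive_energy (l a b : R) (u v xi eta : R -> R) :
  a < b -> regular_curve a b u v -> in_H2plus a b v ->
  C2_on a b xi -> C2_on a b eta ->
  is_derive (fun e => energy_hor l a b (fun t => u t + e * xi t) (fun t => v t + e * eta t)) 0
    (RInt (fun t => variation l (v t) (Derive u t) (Derive v t)
                      (eta t) (Derive xi t) (Derive eta t)) a b).
Proof.
intros Hab Hreg Hplus Hxi Heta.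
assert (Hu := proj1 Hreg); assert (Hv := proj1 (proj2 Hreg)).
set (W := fun (e t : R) => v t + e * eta t).
set (P := fun (e t : R) => Derive u t + e * Derive xi t).
set (Q := fun (e t : R) => Derive v t + e * Derive eta t).
set (L := fun (e t : R) => lagrangian l (W e t) (P e t) (Q e t)).
set (G := fun (e t : R) => variation l (W e t) (P e t) (Q e t)
                             (eta t) (Derive xi t) (Derive eta t)).
set (good := fun e t => 0 < W e t /\ 0 < P e t ^ 2 + Q e t ^ 2).
assert (HL : forall e, RInt (L e) a b
    = energy_hor l a b (fun t => u t + e * xi t) (fun t => v t + e * eta t)).
{ intros e; apply RInt_ext_segment; [lra|]; intros t Ht.
  assert (HD : forall f g, C2_on a b f -> C2_on a b g ->
      Derive (fun s => f s + e * g s) t = Derive f t + e * Derive g t).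
  { intros f g Hf Hg.
    assert (Ef := C1_at_ex_derive _ _ (proj1 (C2_on_C1 _ _ _ t Hf ltac:(lra)))).
    assert (Eg := C1_at_ex_derive _ _ (proj1 (C2_on_C1 _ _ _ t Hg ltac:(lra)))).
    rewrite Derive_plus, Derive_scal; [reflexivity|exact Ef|].
    now auto_derive. }
  now rewrite !HD. }
assert (HLG : forall e t, good e t -> is_derive (fun z => L z t) e (G e t)).
{ intros e t [H1 H2]; now apply is_derive_lagrangian. }
assert (Hsnd : forall (f : R -> R) (e t : R), continuous f t ->
    continuous (fun z : R * R => f (snd z)) (e, t)).
{ intros f e t Hf; apply (continuous_comp (fun z : R * R => snd z) f); [|exact Hf].
  apply continuous_snd. }
assert (Hvar : forall f g (e t : R), continuous f t -> continuous g t ->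
    continuous (fun z : R * R => f (snd z) + fst z * g (snd z)) (e, t)).
{ intros f g e t Hf Hg; apply continuous_Rplus; [now apply Hsnd|].
  apply continuous_Rmult; [apply continuous_fst|now apply Hsnd]. }
assert (C0 : forall f t, C2_on a b f -> a <= t <= b -> continuous f t)
  by (intros f t Hf Ht; exact (C1_at_continuous _ _ (proj1 (C2_on_C1 _ _ _ t Hf Ht)))).
assert (C1 : forall f t, C2_on a b f -> a <= t <= b -> continuous (Derive f) t)
  by (intros f t Hf Ht; exact (C1_at_continuous _ _ (proj2 (C2_on_C1 _ _ _ t Hf Ht)))).
assert (CW : forall e t, a <= t <= b -> continuous (fun z : R * R => W (fst z) (snd z)) (e, t))
  by (intros e t Ht; apply Hvar; now apply C0).
assert (CP : forall e t, a <= t <= b -> continuous (fun z : R * R => P (fst z) (snd z)) (e, t))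
  by (intros e t Ht; apply Hvar; now apply C1).
assert (CQ : forall e t, a <= t <= b -> continuous (fun z : R * R => Q (fst z) (snd z)) (e, t))
  by (intros e t Ht; apply Hvar; now apply C1).
assert (Hgood0 : forall t, a <= t <= b -> good 0 t).
{ intros t Ht; unfold good, W, P, Q; rewrite !Rmult_0_l, !Rplus_0_r; split.
  - specialize (Hplus t Ht); lra.
  - now apply (speed_sq_pos a b). }
assert (Hgood : forall t, a <= t <= b ->
    locally ((0, t) : R * R) (fun z => good (fst z) (snd z))).
{ intros t Ht; destruct (Hgood0 t Ht) as [H1 H2].
  apply filter_and.
  - apply (continuous_locally_pos (fun z : R * R => W (fst z) (snd z))); [now apply CW|exact H1].
  - apply (continuous_locally_pos (fun z : R * R => P (fst z) (snd z) ^ 2 + Q (fst z) (snd z) ^ 2));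
      [|exact H2].
    apply continuous_Rplus; apply continuous_Rpow; [now apply CP|now apply CQ]. }
assert (Hunif := locally_tube 0 a b good Hgood).
apply (is_derive_ext (fun e => RInt (L e) a b)); [exact HL|].
replace (RInt (fun t => variation l (v t) (Derive u t) (Derive v t)
                      (eta t) (Derive xi t) (Derive eta t)) a b)
  with (RInt (fun t => Derive (fun e => L e t) 0) a b).
2:{ apply RInt_ext_segment; [lra|]; intros t Ht.
    transitivity (G 0 t); [apply is_derive_unique, HLG, Hgood0; lra|].
    unfold G, W, P, Q; now rewrite !Rmult_0_l, !Rplus_0_r. }
(* The three conditions left: differentiability in [e] near [0], joint continuity of the derivative
   at [(0, t)], and integrability for small [e]. *)
apply is_derive_RInt_param; rewrite ?Rmin_left, ?Rmax_right by lra.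
- revert Hunif; apply filter_imp; intros e He t Ht.
  exists (G e t); now apply HLG, He.
- intros t Ht; apply continuity_2d_pt_filterlim.
  change (continuous (fun z : R * R => Derive (fun e => L e (snd z)) (fst z)) (0, t)).
  (* The closed form [G] of the derivative is known only where [good] holds, hence merely near
     [(0, t)]. *)
  apply (continuous_ext_loc _ (fun z : R * R => G (fst z) (snd z))).
  + generalize (Hgood t Ht); apply filter_imp; intros [e s] Hz.
    symmetry; now apply is_derive_unique, HLG.
  + destruct (Hgood0 t Ht) as [H1 H2].
    apply (continuous_variation l (fun z : R * R => W (fst z) (snd z))
      (fun z : R * R => P (fst z) (snd z)) (fun z : R * R => Q (fst z) (snd z)) (0, t));
      try assumption.
    * now apply CW.
    * now apply CP.
    * now apply CQ.
    * now apply Hsnd, C0.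
    * now apply Hsnd, C1.
    * now apply Hsnd, C1.
- revert Hunif; apply filter_imp; intros e He.
  apply ex_RInt_segment; [lra|]; intros t Ht.
  destruct (He t Ht) as [H1 H2].
  assert (Hslice : forall F : R -> R -> R, continuous (fun z : R * R => F (fst z) (snd z)) (e, t) ->
      continuous (F e) t).
  { intros F HF; apply (continuous_comp_2 (fun _ => e) (fun s => s) F).
    - apply continuous_const.
    - apply continuous_id.
    - exact HF. }
  apply continuous_lagrangian; try assumption; apply Hslice; auto.
Qed.

(** * Euler-Lagrange equations along the curve *)

(** The curvature equation with its denominator cleared, meaningful also where [ln v + l]
    vanishes. *)
Definition residual (l : R) (u v : R -> R) (t : R) : R :=
  (ln (v t) + l) * kappa_h u v t - Derive u t / sqrt (speed_sq u v t).

Definition momentum_along (l : R) (u v r : R -> R) (t : R) : R :=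
  momentum l (v t) (Derive u t) (Derive v t) (r t).

Definition force_along (l : R) (u v : R -> R) (t : R) : R :=
  force l (v t) (Derive u t) (Derive v t).

Section AlongCurve.

Context (l a b : R) (u v : R -> R).
Hypotheses (Hab : a < b) (Hreg : regular_curve a b u v) (Hplus : in_H2plus a b v).

Let Px := momentum_along l u v (Derive u).
Let Py := momentum_along l u v (Derive v).
Let Fy := force_along l u v.

Let Cu t (Ht : a <= t <= b) : C1_at (Derive u) t := proj2 (C2_on_C1 a b u t (proj1 Hreg) Ht).
Let Cv0 t (Ht : a <= t <= b) : C1_at v t := proj1 (C2_on_C1 a b v t (proj1 (proj2 Hreg)) Ht).
Let Cv t (Ht : a <= t <= b) : C1_at (Derive v) t :=
  proj2 (C2_on_C1 a b v t (proj1 (proj2 Hreg)) Ht).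
Let Hm t (Ht : a <= t <= b) : 0 < Derive u t ^ 2 + Derive v t ^ 2 :=
  speed_sq_pos a b u v t Hreg Ht.

Let Hv t (Ht : a <= t <= b) : 0 < v t.
Proof. specialize (Hplus t Ht); lra. Qed.

Let C1_speed t (Ht : a <= t <= b) :
  C1_at (fun s => sqrt (Derive u s ^ 2 + Derive v s ^ 2)) t.
Proof.
apply (C1_at_comp (fun s => Derive u s ^ 2 + Derive v s ^ 2) sqrt).
- now apply C1_at_plus; apply C1_at_pow; [apply Cu|apply Cv].
- now apply C1_at_sqrt, Hm.
Qed.

Let C1_phi t (Ht : a <= t <= b) : C1_at (fun s => ln (v s) + l) t.
Proof.
apply C1_at_plus; [|apply C1_at_const].
apply (C1_at_comp v ln); [now apply Cv0|now apply C1_at_ln, Hv].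
Qed.

Lemma C1_at_momentum_along (r : R -> R) (t : R) :
  a <= t <= b -> C1_at r t -> C1_at (momentum_along l u v r) t.
Proof.
intros Ht Hr; apply C1_at_div.
- now apply C1_at_mult; [apply C1_phi|].
- now apply C1_at_mult; [apply C1_speed|apply Cv0].
- apply Rmult_lt_0_compat; [now apply sqrt_lt_R0, Hm|now apply Hv].
Qed.

Lemma C1_at_force_along (t : R) : a <= t <= b -> C1_at Fy t.
Proof.
intros Ht; apply C1_at_div.
- apply C1_at_mult; [now apply C1_speed|].
  now apply C1_at_minus; [apply C1_at_const|apply C1_phi].
- now apply C1_at_pow, Cv0.
- now apply pow_lt, Hv.
Qed.

(** The quotient rule, with [s' = (u' u'' + v' v'') / s] and common denominator [s ^ 3 v ^ 2].
    Leaving [r] general covers both momenta. *)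
Lemma Derive_momentum_along (r : R -> R) (t : R) :
  a <= t <= b -> ex_derive r t ->
  Derive (momentum_along l u v r) t =
    ((Derive v t * r t + (ln (v t) + l) * Derive r t * v t) * speed_sq u v t
     - (ln (v t) + l) * r t
       * (v t * (Derive u t * Derive (Derive u) t + Derive v t * Derive (Derive v) t)
          + speed_sq u v t * Derive v t))
    / (sqrt (speed_sq u v t) ^ 3 * v t ^ 2).
Proof.
intros Ht Er; assert (Hvt := Hv t Ht); assert (Hmt := Hm t Ht).
assert (Hs := sqrt_lt_R0 _ Hmt).
assert (Hq := pow2_sqrt _ (Rlt_le _ _ Hmt)).
assert (Eu := C1_at_ex_derive _ _ (Cu t Ht)).
assert (Ev := C1_at_ex_derive _ _ (Cv t Ht)).
assert (Ev0 := C1_at_ex_derive _ _ (Cv0 t Ht)).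
apply is_derive_unique; unfold momentum_along, momentum.
auto_derive.
- repeat split; try assumption.
  apply Rgt_not_eq, Rmult_lt_0_compat; assumption.
- change (fun x => v x) with v; change (fun x => Derive u x) with (Derive u).
  change (fun x => Derive v x) with (Derive v); change (fun x => r x) with r.
  unfold speed_sq.
  replace (Derive u t * (Derive u t * 1) + Derive v t * (Derive v t * 1))
    with (Derive u t ^ 2 + Derive v t ^ 2) by ring.
  set (s := sqrt _) in *; rewrite <- Hq; field; lra.
Qed.

(** Both Euler-Lagrange expressions are multiples of the single scalar
    [residual]: the energy does not depend on the parametrization, so its
    gradient is normal to the curve. *)
Lemma Derive_momentum_x (t : R) :
  a <= t <= b ->
  Derive (momentum_along l u v (Derive u)) t = - residual l u v t * Derive v t / v t ^ 2.
Proof.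
intros Ht; assert (Hvt := Hv t Ht); assert (Hmt := Hm t Ht).
assert (Hs := sqrt_lt_R0 _ Hmt).
assert (Hq := pow2_sqrt _ (Rlt_le _ _ Hmt)).
rewrite Derive_momentum_along by (try apply C1_at_ex_derive; auto).
unfold residual; rewrite kappa_hE by assumption; unfold speed_sq in *.
set (s := sqrt _) in *.
(* The first equality uses [s ^ 2 = u' ^ 2 + v' ^ 2]; the second holds for every nonzero [s]. *)
transitivity (- ((ln (v t) + l)
    * (v t * (Derive u t * Derive (Derive v) t - Derive (Derive u) t * Derive v t)
       + Derive u t * s ^ 2) - Derive u t * s ^ 2) * Derive v t / (s ^ 3 * v t ^ 2)).
- rewrite Hq; field; lra.
- field; lra.
Qed.

Lemma Derive_momentum_y (t : R) :
  a <= t <= b ->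
  Derive (momentum_along l u v (Derive v)) t
    = force_along l u v t + residual l u v t * Derive u t / v t ^ 2.
Proof.
intros Ht; assert (Hvt := Hv t Ht); assert (Hmt := Hm t Ht).
assert (Hs := sqrt_lt_R0 _ Hmt).
assert (Hq := pow2_sqrt _ (Rlt_le _ _ Hmt)).
rewrite Derive_momentum_along by (try apply C1_at_ex_derive; auto).
unfold residual; rewrite kappa_hE by assumption.
unfold force_along, force, speed_sq in *.
set (s := sqrt _) in *.
(* Over the denominator [s ^ 3 v ^ 2] the force has the factor [s ^ 4], written [s ^ 2 * s ^ 2] so
   that [Hq] rewrites it. *)
transitivity ((s ^ 2 * s ^ 2 * (1 - (ln (v t) + l)) + ((ln (v t) + l)
    * (v t * (Derive u t * Derive (Derive v) t - Derive (Derive u) t * Derive v t)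
       + Derive u t * s ^ 2) - Derive u t * s ^ 2) * Derive u t) / (s ^ 3 * v t ^ 2)).
- rewrite Hq; field; lra.
- field; lra.
Qed.

(** With zero residual, [Px' = 0] and [Py'] is the force, so the integrand is the exact derivative
    of [Px xi + Py eta], which vanishes at both ends. *)
Lemma RInt_variation_residual0 (xi eta : R -> R) :
  (forall t, a <= t <= b -> residual l u v t = 0) ->
  C2_on a b xi -> C2_on a b eta ->
  xi a = 0 -> xi b = 0 -> eta a = 0 -> eta b = 0 ->
  RInt (fun t => variation l (v t) (Derive u t) (Derive v t)
                   (eta t) (Derive xi t) (Derive eta t)) a b = 0.
Proof.
intros HE Hxi Heta Hxa Hxb Hea Heb.
set (S := fun t => Px t * xi t + Py t * eta t).
assert (CS : forall t, a <= t <= b -> C1_at S t).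
{ intros t Ht; apply C1_at_plus; apply C1_at_mult.
  - now apply C1_at_momentum_along; [|apply Cu].
  - exact (proj1 (C2_on_C1 _ _ _ t Hxi Ht)).
  - now apply C1_at_momentum_along; [|apply Cv].
  - exact (proj1 (C2_on_C1 _ _ _ t Heta Ht)). }
transitivity (RInt (Derive S) a b).
- apply RInt_ext_segment; [lra|]; intros t Ht.
  assert (Dx := C1_at_ex_derive _ _ (C1_at_momentum_along _ t Ht (Cu t Ht))).
  assert (Dy := C1_at_ex_derive _ _ (C1_at_momentum_along _ t Ht (Cv t Ht))).
  assert (Exi := C1_at_ex_derive _ _ (proj1 (C2_on_C1 _ _ _ t Hxi Ht))).
  assert (Eeta := C1_at_ex_derive _ _ (proj1 (C2_on_C1 _ _ _ t Heta Ht))).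
  unfold S, Px, Py.
  rewrite Derive_plus, !Derive_mult by (auto using ex_derive_mult).
  rewrite Derive_momentum_x, Derive_momentum_y, HE by exact Ht.
  unfold variation, momentum_along, force_along; field.
  apply Rgt_not_eq, Hv, Ht.
- rewrite RInt_Derive_C1 by assumption.
  unfold S; rewrite Hxa, Hxb, Hea, Heb.
  now rewrite !Rmult_0_r, Rplus_0_r, Rminus_0_r.
Qed.

(** Horizontal variations give [Px' = 0] and vertical ones give that [Py'] is the force. These are
    [residual * v' = 0] and [residual * u' = 0], and [u'], [v'] do not vanish together. *)
Lemma RInt_variation0_residual :
  (forall xi eta : R -> R, C2_on a b xi -> C2_on a b eta ->
     xi a = 0 -> xi b = 0 -> eta a = 0 -> eta b = 0 ->
     RInt (fun t => variation l (v t) (Derive u t) (Derive v t)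
                      (eta t) (Derive xi t) (Derive eta t)) a b = 0) ->
  forall t, a <= t <= b -> residual l u v t = 0.
Proof.
intros Hcrit.
assert (C2_zero : C2_on a b (fun _ => 0)).
{ assert (D0 : forall s, Derive (fun _ : R => 0) s = 0) by (intros s; apply Derive_const).
  intros t Ht; split.
  - apply filter_forall; intros s; split; [now auto_derive|].
    apply ex_derive_ext with (fun _ => 0); [now intros|now auto_derive].
  - apply continuous_ext with (fun _ => 0); [|apply continuous_const].
    intros s; rewrite (Derive_ext _ (fun _ => 0)) by exact D0; now rewrite D0. }
assert (Hx : forall t, a <= t <= b -> Derive Px t = 0).
{ apply du_Bois_Reymond_C1; [exact Hab| |].
  - intros t Ht; now apply C1_at_momentum_along; [|apply Cu].
  - intros F HF HFa HFb.
    rewrite <- (Hcrit F (fun _ => 0) HF C2_zero HFa HFb eq_refl eq_refl).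
    apply RInt_ext_segment; [lra|]; intros t _.
    rewrite Derive_const; unfold variation, Px, momentum_along; ring. }
(* Integrating by parts against a primitive [D] of the force turns the vertical first variation into
   the integral of [(Py - D) F'], the form required by du Bois-Reymond. *)
destruct (C1_antiderivative Fy a b Hab C1_at_force_along) as (D & HD & HDa & HDb & HDd).
assert (CD : forall t, a <= t <= b -> C1_at D t)
  by (intros t Ht; exact (proj1 (C2_on_C1 _ _ _ t HD Ht))).
assert (CPy : forall t, a <= t <= b -> C1_at Py t)
  by (intros t Ht; now apply C1_at_momentum_along; [|apply Cv]).
assert (Hy : forall t, a <= t <= b -> Derive (fun s => Py s - D s) t = 0).
{ apply du_Bois_Reymond_C1; [exact Hab| |].
  - intros t Ht; now apply C1_at_minus; [apply CPy|apply CD].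
  - intros F HF HFa HFb.
    assert (CF : forall t, a <= t <= b -> C1_at F t)
      by (intros t Ht; exact (proj1 (C2_on_C1 _ _ _ t HF Ht))).
    assert (CF' : forall t, a <= t <= b -> C1_at (Derive F) t)
      by (intros t Ht; exact (proj2 (C2_on_C1 _ _ _ t HF Ht))).
    assert (CDF : forall t, a <= t <= b -> C1_at (fun s => D s * F s) t)
      by (intros t Ht; now apply C1_at_mult; [apply CD|apply CF]).
    assert (H0 : RInt (fun t => Fy t * F t + Py t * Derive F t) a b = 0).
    { rewrite <- (Hcrit (fun _ => 0) F C2_zero HF eq_refl eq_refl HFa HFb).
      apply RInt_ext_segment; [lra|]; intros t _.
      rewrite Derive_const; unfold variation, Fy, Py, force_along, momentum_along; ring. }
    transitivity (RInt (fun t => minus (Fy t * F t + Py t * Derive F t)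
                                   (Derive (fun s => D s * F s) t)) a b).
    + apply RInt_ext_segment; [lra|]; intros t Ht.
      rewrite Derive_mult by (apply C1_at_ex_derive; auto).
      rewrite HDd by exact Ht.
      change ((Py t - D t) * Derive F t
        = Fy t * F t + Py t * Derive F t - (Fy t * F t + D t * Derive F t)); ring.
    + rewrite (RInt_minus (V := R_CompleteNormedModule)).
      * rewrite H0, (RInt_Derive_C1 _ _ _ Hab CDF), HFa, HFb.
        change (0 - (D b * 0 - D a * 0) = 0); ring.
      * apply ex_RInt_segment; [lra|]; intros t Ht.
        apply C1_at_continuous, C1_at_plus; apply C1_at_mult; auto using C1_at_force_along.
      * apply ex_RInt_segment; [lra|]; intros t Ht; now apply CDF. }
intros t Ht; assert (Hvt := Hv t Ht); assert (Hmt := Hm t Ht).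
assert (Ex := Hx t Ht); assert (Ey := Hy t Ht).
rewrite Derive_minus, HDd in Ey by (try apply C1_at_ex_derive; auto).
unfold Px, Py in Ex, Ey; rewrite Derive_momentum_x in Ex by exact Ht.
rewrite Derive_momentum_y in Ey by exact Ht; fold Fy in Ey.
set (e := residual l u v t) in *.
assert (Hxe : e * Derive v t = 0).
{ replace (e * Derive v t) with (- (- e * Derive v t / v t ^ 2) * v t ^ 2) by (field; lra).
  rewrite Ex; ring. }
assert (Hye : e * Derive u t = 0).
{ replace (e * Derive u t)
    with ((Fy t + e * Derive u t / v t ^ 2 - Fy t) * v t ^ 2) by (field; lra).
  rewrite Ey; ring. }
destruct (Rmult_integral _ _ Hxe) as [H|H1]; [exact H|].
destruct (Rmult_integral _ _ Hye) as [H|H2]; [exact H|].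
rewrite H1, H2 in Hmt; lra.
Qed.

(** Used to spread a nonzero value of the residual to an interval. *)
Lemma continuous_residual (t : R) : a <= t <= b -> continuous (residual l u v) t.
Proof.
intros Ht; assert (Hvt := Hv t Ht); assert (Hmt := Hm t Ht).
set (s := fun r => sqrt (Derive u r ^ 2 + Derive v r ^ 2)).
apply continuous_ext_loc with (fun r => (ln (v r) + l)
    * (v r * (Derive u r * Derive (Derive v) r - Derive (Derive u) r * Derive v r) / s r ^ 3
       + Derive u r / s r) - Derive u r / s r).
(* The explicit curvature formula needs positive height and speed; both persist on a full
   neighbourhood of [t], which may leave [[a, b]]. *)
- assert (Ks := continuous_locally_pos v t (C1_at_continuous _ _ (Cv0 t Ht)) Hvt).
  assert (Km : locally t (fun r => 0 < Derive u r ^ 2 + Derive v r ^ 2)).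
  { apply (continuous_locally_pos (fun r => Derive u r ^ 2 + Derive v r ^ 2)); [|exact Hmt].
    apply C1_at_continuous, C1_at_plus; apply C1_at_pow; auto. }
  generalize (filter_and _ _ Ks Km); apply filter_imp; intros r [H1 H2].
  unfold residual; now rewrite kappa_hE.
- assert (Hs : 0 < s t) by now apply sqrt_lt_R0.
  assert (Ks : continuous s t) by now apply C1_at_continuous, C1_speed.
  assert (Ku := C1_at_continuous _ _ (Cu t Ht)).
  assert (Kv := C1_at_continuous _ _ (Cv t Ht)).
  assert (Kv0 := C1_at_continuous _ _ (Cv0 t Ht)).
  assert (Ku' := proj2 (Cu t Ht)); assert (Kv' := proj2 (Cv t Ht)).
  assert (Kus : continuous (fun r => Derive u r / s r) t)
    by (apply continuous_Rdiv; [exact Ku|exact Ks|lra]).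
  apply continuous_Rminus; [|exact Kus].
  apply continuous_Rmult; [now apply C1_at_continuous, C1_phi|].
  apply continuous_Rplus; [|exact Kus].
  apply continuous_Rdiv.
  + apply continuous_Rmult; [exact Kv0|].
    now apply continuous_Rminus; apply continuous_Rmult.
  + now apply continuous_Rpow.
  + apply pow_nonzero; lra.
Qed.

(** * The curvature equation at zeros of [ln v + l] *)

Lemma kappa_h_horocycle (t : R) :
  a <= t <= b -> Derive v t = 0 -> Derive (Derive v) t = 0 ->
  kappa_h u v t = Derive u t / sqrt (speed_sq u v t).
Proof.
intros Ht H1 H2; assert (Hs := sqrt_lt_R0 _ (Hm t Ht)).
rewrite kappa_hE by (try apply Hm; auto); rewrite H1, H2; unfold speed_sq in *.
unfold Rdiv; ring.
Qed.

(** At a point with [ln v + l = 0] a quotient by [ln v + l] is [0] in Rocq.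
    There the momentum [Px] vanishes, hence everywhere, and the curve is a
    vertical line, whose curvature is indeed [0]. *)
Lemma residual0_quotient :
  (forall t, a <= t <= b -> residual l u v t = 0) ->
  forall t, a <= t <= b ->
    kappa_h u v t = Derive u t / sqrt (speed_sq u v t) / (ln (v t) + l).
Proof.
intros HE t Ht.
destruct (Req_dec (ln (v t) + l) 0) as [H0|H0].
2:{ assert (H := HE t Ht); unfold residual in H.
    replace (Derive u t / sqrt (speed_sq u v t))
      with ((ln (v t) + l) * kappa_h u v t) by lra.
    field; exact H0. }
assert (HPx : forall s, a <= s <= b -> Px s = 0).
{ assert (Pt : Px t = 0)
    by (unfold Px, momentum_along, momentum; rewrite H0; unfold Rdiv; ring).
  assert (Hd : forall s, a <= s <= b -> is_derive Px s 0).
  { intros s Hs; replace 0 with (Derive Px s).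
    - now apply Derive_correct, C1_at_ex_derive, C1_at_momentum_along; [|apply Cu].
    - unfold Px; rewrite Derive_momentum_x, HE by exact Hs; unfold Rdiv; ring. }
  intros s Hs.
  destruct (Rtotal_order s t) as [Hst|[Hst|Hst]].
  - rewrite <- Pt.
    apply (eq_is_derive (V := R_NormedModule)); [intros r Hr; apply Hd; lra|exact Hst].
  - now rewrite Hst.
  - rewrite <- Pt; symmetry.
    apply (eq_is_derive (V := R_NormedModule)); [intros r Hr; apply Hd; lra|exact Hst]. }
(* [Px = 0] means [(ln v + l) u' = 0]. Where the first factor vanishes, the residual equation
   reduces to [- u' / s = 0], so [u' = 0] there as well. *)
assert (Hu' : forall s, a <= s <= b -> Derive u s = 0).
{ intros s Hs; assert (Hvs := Hv s Hs); assert (Hms := Hm s Hs).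
  assert (Hss := sqrt_lt_R0 _ Hms).
  assert (H1 := HPx s Hs); assert (H2 := HE s Hs).
  unfold Px, momentum_along, momentum in H1.
  unfold residual, speed_sq in H2; set (r := sqrt _) in *.
  assert (H3 : (ln (v s) + l) * Derive u s = 0).
  { replace ((ln (v s) + l) * Derive u s)
      with ((ln (v s) + l) * Derive u s / (r * v s) * (r * v s)) by (field; lra).
    rewrite H1; ring. }
  destruct (Rmult_integral _ _ H3) as [H4|H4]; [|exact H4].
  rewrite H4 in H2.
  replace (Derive u s) with (- (0 * kappa_h u v s - Derive u s / r) * r) by (field; lra).
  rewrite H2; ring. }
rewrite kappa_hE by (try apply Hm; auto).
rewrite (Derive_const_segment (Derive u) 0 a b t Hab Ht) by (try apply C1_at_ex_derive; auto).
rewrite Hu' by exact Ht; unfold Rdiv; ring.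
Qed.

(** If the residual were nonzero at a zero of [ln v + l], then by continuity
    [ln v + l] would vanish nearby: the curve would be a piece of a horocycle,
    of curvature [+-1] rather than the value [0] of the quotient. *)
Lemma quotient_residual0 :
  (forall t, a <= t <= b ->
    kappa_h u v t = Derive u t / sqrt (speed_sq u v t) / (ln (v t) + l)) ->
  forall t, a <= t <= b -> residual l u v t = 0.
Proof.
intros HK.
assert (Hnz : forall t, a <= t <= b -> residual l u v t <> 0 -> ln (v t) + l = 0).
{ intros t Ht HE; destruct (Req_dec (ln (v t) + l) 0) as [H0|H0]; [exact H0|].
  exfalso; apply HE; unfold residual; rewrite HK by exact Ht.
  assert (Hs := sqrt_lt_R0 _ (Hm t Ht)); unfold speed_sq; set (s := sqrt _) in *.
  field; lra. }
intros t Ht; destruct (Req_dec (residual l u v t) 0) as [H0|H0]; [exact H0|].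
exfalso.
destruct (continuous_locally_neq0 _ _ (continuous_residual t Ht) H0) as [d Hd].
assert (Hdp := cond_pos d).
(* As [t] may be an endpoint, the interval around it is cut down to [[a, b]]; it keeps positive
   length, as [Derive_const_segment] requires. *)
set (a' := Rmax a (t - d / 2)); set (b' := Rmin b (t + d / 2)).
assert (Hab' : a' < b').
{ unfold a', b'; apply Rmax_lub_lt; apply Rmin_glb_lt; lra. }
assert (Ht' : a' <= t <= b').
{ unfold a', b'; split; [apply Rmax_lub|apply Rmin_glb]; lra. }
assert (Hsub : forall s, a' <= s <= b' -> a <= s <= b /\ Rabs (s - t) < d).
{ intros s Hs; unfold a', b' in Hs.
  assert (a <= Rmax a (t - d / 2)) by apply Rmax_l.
  assert (t - d / 2 <= Rmax a (t - d / 2)) by apply Rmax_r.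
  assert (Rmin b (t + d / 2) <= b) by apply Rmin_l.
  assert (Rmin b (t + d / 2) <= t + d / 2) by apply Rmin_r.
  split; [lra|apply Rabs_def1; lra]. }
assert (Hphi : forall s, a' <= s <= b' -> ln (v s) + l = 0).
{ intros s Hs; destruct (Hsub s Hs) as [Hs1 Hs2]; apply Hnz; [exact Hs1|now apply Hd]. }
assert (Hv1 : forall s, a' <= s <= b' -> Derive v s = 0).
(* [ln v + l = 0] puts the curve on the horocycle at height [exp (- l)]. *)
{ intros s Hs; apply (Derive_const_segment v (exp (- l)) a' b'); try assumption.
  - now apply C1_at_ex_derive, Cv0, Hsub.
  - intros r Hr; rewrite <- (exp_ln (v r)) by now apply Hv, Hsub.
    f_equal; specialize (Hphi r Hr); lra. }
assert (Hv2 : Derive (Derive v) t = 0).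
{ apply (Derive_const_segment (Derive v) 0 a' b'); try assumption.
  now apply C1_at_ex_derive, Cv. }
assert (H1 := kappa_h_horocycle t Ht (Hv1 t Ht') Hv2).
assert (H2 := HK t Ht).
(* The zero denominator forces [kappa_h = 0]; since [kappa_h = u' / s] here, the residual would be
   [0]. *)
rewrite (Hphi t Ht') in H2; unfold Rdiv at 1 in H2; rewrite Rinv_0, Rmult_0_r in H2.
apply H0; unfold residual; rewrite <- H1, H2; ring.
Qed.

End AlongCurve.

Theorem corollary3p13 (lambda a b : R) (u v : R -> R)
    (hab : a < b)
    (hreg : regular_curve a b u v)
    (hplus : in_H2plus a b v) :
  horo_catenary lambda a b u v <->
  (forall t : R, a <= t <= b ->
     kappa_h u v t =
       hyp_metric (u t, v t) (unit_normal u v t) (V (u t, v t))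
       / (d_b (u t, v t) + lambda)).
Proof.
assert (HV : forall t, a <= t <= b ->
    hyp_metric (u t, v t) (unit_normal u v t) (V (u t, v t))
    = Derive u t / sqrt (speed_sq u v t)).
{ intros t Ht; assert (Hs := sqrt_lt_R0 _ (speed_sq_pos a b u v t hreg Ht)).
  specialize (hplus t Ht).
  unfold hyp_metric, unit_normal, V; simpl fst; simpl snd; unfold speed_sq.
  set (s := sqrt _) in *; field; lra. }
transitivity (forall t, a <= t <= b -> residual lambda u v t = 0); split.
- intros Hcrit; apply RInt_variation0_residual; try assumption.
  intros xi eta Hxi Heta Hxa Hxb Hea Heb.
  (* The energy is differentiable along every admissible variation, so criticality says exactly that
     this integral vanishes. *)
  assert (H := is_derive_energy lambda a b u v xi eta hab hreg hplus Hxi Heta).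
  rewrite <- (is_derive_unique _ _ _ H).
  now apply is_derive_unique, Hcrit.
- intros HE xi eta Hxi Heta Hxa Hxb Hea Heb.
  assert (H := is_derive_energy lambda a b u v xi eta hab hreg hplus Hxi Heta).
  now rewrite RInt_variation_residual0 in H.
- intros HE t Ht; rewrite HV by exact Ht; unfold d_b; simpl snd.
  now apply (residual0_quotient lambda a b).
- intros HK; apply quotient_residual0; try assumption.
  intros t Ht; rewrite HK, HV by exact Ht; reflexivity.
Qed.
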